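(* Let $1<p<q<\infty$. Then $\ell_q$ is not a uniform quotient of $\ell_p$; that is, there is no surjective map $T:\ell_p\to\ell_q$ that is both uniformly continuous and co-uniformly continuous.
   Context: All balls are closed: $B(x,r)=\{y: d(x,y)\le r\}$. A map $T:X\to Y$ between metric spaces is called co-uniformly continuous if for every $\varepsilon>0$ there exists $\delta>0$ such that for every $x\in X$, $B(Tx,\delta)\subseteq T(B(x,\varepsilon))$. A map is a uniform quotient map if it is both uniformly continuous and co-uniformly continuous; if it is also surjective, $Y$ is called a uniform quotient of $X$. Here $\ell_p$ and $\ell_q$ carry the metrics induced by their usual norms; $T$ is not assumed linear. *)

(* Defs.v *)
From HB Require Import structures.
From mathcomp Require Import all_boot all_order all_algebra.
From mathcomp Require Import all_classical all_reals all_analysis.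
Import Order.TTheory GRing.Theory Num.Theory.
Import numFieldNormedType.Exports.

Set Implicit Arguments.
Unset Strict Implicit.
Unset Printing Implicit Defensive.

Local Open Scope classical_set_scope.
Local Open Scope ring_scope.

Section uniform_quotient.
Context {R : numDomainType}.
Implicit Types X Y : metricType R.

(* [closed_ball] of the library is the closure of the open ball, which in a
   metric space can be smaller than [set y | mdist x y <= r]. *)
Definition mclosed_ball X (x : X) (r : R) : set X := [set y | mdist x y <= r].

Definition co_unif_continuous X Y (T : X -> Y) : Prop :=
  forall e : R, 0 < e -> exists2 d : R, 0 < d &
    forall x : X, mclosed_ball (T x) d `<=` T @` mclosed_ball x e.

Definition uniform_quotient_map X Y (T : X -> Y) : Prop :=
  unif_continuous T /\ co_unif_continuous T.

Definition uniform_quotient_of Y X : Prop :=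
  exists T : X -> Y, uniform_quotient_map T /\ range T = setT.

End uniform_quotient.

Lemma metric_unif_continuousP (R : numFieldType) (X Y : metricType R)
    (T : X -> Y) :
  unif_continuous T <->
  forall e : R, 0 < e -> exists2 d : R, 0 < d &
    forall x y : X, mdist x y < d -> mdist (T x) (T y) < e.
Proof.
rewrite /unif_continuous -!entourage_ballE; split => [cT e e0|cT A [e/= e0 eA]].
  have [|d/= d0 dT] := cT [set xy | ball xy.1 e xy.2]; first by exists e.
  exists d => // x y xy.
  have /= := dT (x, y); rewrite !ballEmdist/=; exact.
have [d d0 dT] := cT _ e0; exists d => //= -[x y]/= xy; apply: eA => /=.
by rewrite ballEmdist/=; apply: dT; move: xy; rewrite ballEmdist.
Qed.

(* The real space l_p for 1 <= p < oo.  Equality of elements of [LfunType] is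
   equality of functions (not almost everywhere), and every function on nat is
   measurable: the elements are exactly the sequences x : nat -> R with finite
   l_p norm. *)
Definition ell (R : realType) (p : R) (p1 : 1 <= p) : Type :=
  LfunType (@counting nat R) (p1 : (1 <= p%:E)%E).

Section ell_normed.
Context (R : realType) (p : R) (p1 : 1 <= p).

HB.instance Definition _ := GRing.Lmodule.on (ell p1).

Definition ell_norm (x : ell p1) : R :=
  fine ('N[@counting nat R]_p%:E[EFin \o x])%E.

Let ell_normD (x y : ell p1) : ell_norm (x + y) <= ell_norm x + ell_norm y.
Proof. exact: (@ler_LnormD _ _ _ (@counting nat R) p%:E p1). Qed.

Let ell_normZ (a : R) (x : ell p1) : ell_norm (a *: x) = `|a| * ell_norm x.
Proof.
apply: EFin_inj; rewrite EFinM /ell_norm.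
rewrite !(@finite_norm_fine _ _ R (@counting nat R) p%:E p1).
exact: (@LnormZ _ _ _ (@counting nat R) p%:E p1).
Qed.

Lemma ell_normE (x : ell p1) :
  ((ell_norm x)%:E = (\sum_(k <oo) (`|x k| `^ p)%:E) `^ p^-1)%E.
Proof.
have p0 : 0 < p by exact: lt_le_trans p1.
rewrite /ell_norm (@finite_norm_fine _ _ R (@counting nat R) p%:E p1).
by rewrite Lnorm_counting.
Qed.

Let ell_norm_eq0 (x : ell p1) : ell_norm x = 0 -> x = 0.
Proof.
have p0 : 0 < p by exact: lt_le_trans p1.
move=> x0; have := ell_normE x; rewrite x0 => /esym/eqP.
rewrite poweR_eq0; last by apply: nneseries_ge0 => *; rewrite lee_fin powR_ge0.
case/andP=> /eqP s0 _; apply/LfuneqP => k.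
have : ((`|x k| `^ p)%:E <= 0 :> \bar R)%E.
  rewrite -s0 (nneseries_split 0 k.+1); last first.
    by move=> *; rewrite lee_fin powR_ge0.
  rewrite big_nat_recr//= -[leLHS]add0e -[leLHS]adde0.
  apply: leeD; last by apply: nneseries_ge0 => *; rewrite lee_fin powR_ge0.
  by apply: leeD => //; apply: sume_ge0 => *; rewrite lee_fin powR_ge0.
rewrite lee_fin => xk; have : `|x k| `^ p == 0 by rewrite eq_le xk powR_ge0.
by rewrite powR_eq0 normr_eq0 => /andP[/eqP].
Qed.

HB.instance Definition _ :=
  Lmodule_isNormed.Build R (ell p1) ell_normD ell_normZ ell_norm_eq0.

Let ell_dist (x y : ell p1) : R := `|x - y|.

Let ell_dist_ge0 x y : 0 <= ell_dist x y.
Proof. exact: normr_ge0. Qed.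

Let ell_dist_eq0 x y : ell_dist x y = 0 -> x = y.
Proof. by move=> /normr0_eq0/eqP; rewrite subr_eq0 => /eqP. Qed.

Let ell_ballE (x : ell p1) (d : R) : ball x d = [set y | ell_dist x y < d].
Proof. by rewrite -ball_normE. Qed.

HB.instance Definition _ :=
  PseudoMetric_isMetric.Build R (ell p1) ell_dist_ge0 ell_dist_eq0 ell_ballE.

End ell_normed.

Lemma ell_mdistE (R : realType) (p : R) (p1 : 1 <= p) (x y : ell p1) :
  ((mdist x y)%:E = (\sum_(k <oo) (`|x k - y k| `^ p)%:E) `^ p^-1)%E.
Proof. exact: (ell_normE (x - y)). Qed.

Lemma ellP (R : realType) (p : R) (p1 : 1 <= p) (u : nat -> R) :
  (\sum_(k <oo) (`|u k| `^ p)%:E < +oo)%E <->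
  exists x : ell p1, u = x :> (nat -> R).
Proof.
have p0 : 0 < p by exact: lt_le_trans p1.
have normE (f : nat -> R) : ('N[@counting nat R]_p%:E[EFin \o f])%E =
    ((\sum_(k <oo) (`|f k| `^ p)%:E) `^ p^-1)%E by rewrite Lnorm_counting.
have pV0 : p^-1 != 0 by rewrite invr_eq0 gt_eqF.
split => [uoo|[x ->]].
  have uL : u \in Lfun (@counting nat R) p%:E.
    rewrite inE; apply/andP; split; first by rewrite inE.
    by rewrite inE /finite_norm /= normE; apply: poweR_lty.
  by exists (@Lfun_Sub _ _ _ _ _ (p1 : (1 <= p%:E)%E) u uL).
have := @Lfunction_finite _ _ _ _ _ (p1 : (1 <= p%:E)%E) x.
rewrite /finite_norm normE !ltey; apply: contra => /eqP ->.
by rewrite poweRyr.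
Qed.

(* Main.v *)
(* At large distances T is Lipschitz and co-Lipschitz.  Suppose every y lifts
   to a point within C |y - T x| + D of x.  In l_q, the pencil of broken
   segments T x, m, y_n, y with m = T x + v / 4, y_n = T x + v / 2 + s |v| e_n
   and v = y - T x costs a relative excess of order s^q only, while the lifts
   of the y_n are separated by a multiple of s |v|.  By property (beta) of l_p,
   some lift of y_n is closer to x, by a relative amount of order s^p, than the
   length of the lifted path.  As p < q, a small fixed s improves C to lam C
   with lam < 1 independent of C, and iterating contradicts the lower bound on C
   coming from the Lipschitz estimate. *)
Require Import Defs.
From mathcomp Require Import all_boot all_order all_algebra.
From mathcomp Require Import all_classical all_reals all_analysis.
From mathcomp Require Import ring lra.
Import Order.TTheory GRing.Theory Num.Theory.

Set Implicit Arguments.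
Unset Strict Implicit.
Unset Printing Implicit Defensive.

Local Open Scope ring_scope.

(** * Real powers and a pigeonhole principle *)

Lemma ler_powRl (R : realType) (p x y : R) : 0 < p -> 0 <= x -> 0 <= y ->
  (x `^ p <= y `^ p) = (x <= y).
Proof.
move=> p0 x0 y0; case: (lerP x y) => [xy|yx].
  by rewrite ge0_ler_powR ?nnegrE// ltW.
by apply/negbTE; rewrite -ltNge gt0_ltr_powR ?nnegrE.
Qed.

(** Pigeonhole: [[-M, M]] is cut into cells of width [d], and each [n] is sent to the pattern of
    cells met by its first [N] terms. There are finitely many patterns. *)
Lemma bounded_heads_close (R : realType) (w : nat -> nat -> R) (N : nat)
    (M d : R) : 0 < d -> (forall n k, `|w n k| <= M) ->
  exists n m, n != m /\ forall k, (k < N)%N -> `|w n k - w m k| <= d.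
Proof.
move=> d0 wM; pose t n k := Num.truncn ((w n k + M) / d).
have arg_ge0 n k : 0 <= (w n k + M) / d.
  by rewrite divr_ge0 ?(ltW d0)//; have := wM n k; rewrite ler_norml; lra.
pose K := Num.truncn (2 * M / d).
have tK n k : (t n k < K.+1)%N.
  rewrite ltnS le_truncn// ler_pM2r ?invr_gt0//.
  by have := wM n k; rewrite ler_norml; lra.
(* The domain has one index more than there are patterns. *)
pose g (n : 'I_#|{ffun 'I_N -> 'I_K.+1}|.+1) : {ffun 'I_N -> 'I_K.+1} :=
  [ffun k : 'I_N => Ordinal (tK n k)].
have /injectivePn[n [m nm gnm]] : ~~ injectiveb g.
  by apply/injectiveP => /leq_card; rewrite card_ord ltnn.
exists (nat_of_ord n), (nat_of_ord m); split => // k kN.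
have : t n k = t m k.
  by have /ffunP/(_ (Ordinal kN)) := gnm; rewrite !ffunE => /(congr1 val).
rewrite /t => tnm.
have := truncn_itv (arg_ge0 n k); have := truncn_itv (arg_ge0 m k).
rewrite tnm; set T := Num.truncn _; rewrite -natr1.
rewrite !ler_pdivlMr ?ltr_pdivrMr// => /andP[m1 m2] /andP[n1 n2].
by rewrite ler_norml; apply/andP; split; lra.
Qed.

(** Convexity of the [p]-th power at the midpoint of [2 * a] and [2 * b]. *)
Lemma powRD_le (R : realType) (p a b : R) : 1 <= p -> 0 <= a -> 0 <= b ->
  (a + b) `^ p <= 2 `^ (p - 1) * (a `^ p + b `^ p).
Proof.
move=> p1 a0 b0.
have half : (2^-1 * (2 * a) + 2^-1 * (2 * b)) `^ p <=
    2^-1 * (2 * a) `^ p + 2^-1 * (2 * b) `^ p.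
  rewrite {2 4}(_ : 2^-1 = 1 - 2^-1); last by lra.
  by apply: (convex_powR p1 (Itv01 _ _)) => //=; rewrite ?inE/= ?in_itv/=;
    lra.
have -> : a + b = 2^-1 * (2 * a) + 2^-1 * (2 * b) by lra.
apply: le_trans half _.
rewrite !powRM// powRB; last by rewrite pnatr_eq0 implybT.
rewrite powRr1//; lra.
Qed.

(** * Restrictions, tails and single-coordinate perturbations in l_p *)

Section ell_theory.
Context {R : realType} {p : R} {p1 : 1 <= p}.
Implicit Types (x y : ell p1) (A : pred nat).

Let p0 : 0 < p. Proof. exact: lt_le_trans p1. Qed.

Lemma ell_ext x y : x =1 y -> x = y.
Proof. by move/LfuneqP. Qed.

Lemma ellBE x y k : (x - y) k = x k - y k. Proof. by []. Qed.

Lemma ellDE x y k : (x + y) k = x k + y k. Proof. by []. Qed.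

Lemma ell_norm_powE x :
  ((`|x| `^ p)%:E = \sum_(k <oo) (`|x k| `^ p)%:E)%E.
Proof.
rewrite -poweR_EFin ell_normE -poweRrM mulVf ?gt_eqF// poweRe1//.
by apply: nneseries_ge0 => *; rewrite lee_fin powR_ge0.
Qed.

Lemma ell_restr_subproof A x :
  exists y : ell p1, (fun k => if A k then x k else 0) = y :> (nat -> R).
Proof.
apply/(@ellP R p p1).
apply: (@le_lt_trans _ _ (\sum_(k <oo) (`|x k| `^ p)%:E)%E).
  apply: lee_nneseries => [k _ _|k _]; rewrite lee_fin ?powR_ge0//.
  by case: ifP => // _; rewrite normr0 powR0 ?powR_ge0// gt_eqF.
by rewrite -ell_norm_powE ltry.
Qed.

Definition ell_restr A x : ell p1 := projT1 (cid (ell_restr_subproof A x)).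

Lemma ell_restrE A x k : ell_restr A x k = if A k then x k else 0.
Proof. by rewrite /ell_restr; case: cid => y /= <-. Qed.

Lemma ell_restrB A x y : ell_restr A (x - y) = ell_restr A x - ell_restr A y.
Proof.
apply: ell_ext => k; rewrite !(ellBE, ell_restrE).
by case: ifP => // _; rewrite subr0.
Qed.

Lemma ell_restrD A x y : ell_restr A (x + y) = ell_restr A x + ell_restr A y.
Proof.
apply: ell_ext => k; rewrite !(ellDE, ell_restrE).
by case: ifP => // _; rewrite addr0.
Qed.

Lemma ell_restr_norm_pow A x :
  ((`|ell_restr A x| `^ p)%:E = \sum_(k <oo | A k) (`|x k| `^ p)%:E)%E.
Proof.
rewrite ell_norm_powE [RHS]eseries_mkcond; apply: eq_eseriesr => k _.
by rewrite ell_restrE; case: ifP => // _; rewrite normr0 powR0 ?gt_eqF.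
Qed.

Lemma ell_norm_pow_split A x :
  `|x| `^ p = `|ell_restr A x| `^ p + `|ell_restr (predC A) x| `^ p.
Proof.
apply: EFin_inj; rewrite EFinD !ell_norm_powE -nneseriesD; last 2 first.
- by move=> *; rewrite lee_fin powR_ge0.
- by move=> *; rewrite lee_fin powR_ge0.
apply: eq_eseriesr => k _; rewrite !ell_restrE /= -EFinD.
by case: (A k) => /=; rewrite normr0 powR0 ?addr0 ?add0r// gt_eqF.
Qed.

Lemma ell_restr_norm_le A x : `|ell_restr A x| <= `|x|.
Proof.
by rewrite -(ler_powRl p0)// (ell_norm_pow_split A x) lerDl powR_ge0.
Qed.

Lemma ell_norm_pow_coord n x :
  `|x| `^ p = `|x n| `^ p + `|ell_restr (predC1 n) x| `^ p.
Proof.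
rewrite (ell_norm_pow_split (pred1 n)); congr (_ + _).
apply: EFin_inj.
rewrite ell_restr_norm_pow (@nneseriesD1 _ _ n)/=; last 2 first.
- by move=> *; rewrite lee_fin powR_ge0.
- by rewrite eqxx.
rewrite eseries0 ?adde0// => k _ /=; by case: eqP.
Qed.

Lemma ell_coord_le n x : `|x n| <= `|x|.
Proof.
by rewrite -(ler_powRl p0)// (ell_norm_pow_coord n) lerDl powR_ge0.
Qed.

Lemma ell_tail_small x (e : R) : 0 < e ->
  exists N, `|ell_restr (predC (fun k => k < N)%N) x| <= e.
Proof.
move=> e0; have xoo : (\sum_(k <oo) (`|x k| `^ p)%:E < +oo)%E.
  by rewrite -ell_norm_powE ltry.
have ep : nbhs (0%:E : \bar R) [set y | (y < (e `^ p)%:E)%E]%classic.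
  by apply: (@nbhs_open_ereal_lt _ 0 (fun=> e `^ p)); rewrite powR_gt0.
have xN : forall k, xpredT k -> (0 <= (`|x k| `^ p)%:E)%E.
  by move=> *; rewrite lee_fin powR_ge0.
have /(_ _ ep)[N _ /(_ N (leqnn N))/= tN] := nneseries_tail_cvg xoo xN.
exists N; rewrite -(ler_powRl p0) ?(ltW e0)//.
rewrite -lee_fin (le_trans _ (ltW tN))// ell_norm_powE.
rewrite (nneseries_split 0 N); last by move=> *; rewrite lee_fin powR_ge0.
rewrite big_nat big1 ?add0e => [|k /andP[_ kN]]; last first.
  by rewrite ell_restrE /= -[(k < 0 + N)%N]/(k < N)%N kN normr0 powR0 ?gt_eqF.
apply: lee_nneseries => [k _ _|k _]; rewrite lee_fin ?powR_ge0//.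
rewrite ell_restrE; case: ifP => // _.
by rewrite normr0 powR0 ?powR_ge0// gt_eqF.
Qed.

Lemma ell_head_pow_le N x (e : R) : (forall k, (k < N)%N -> `|x k| <= e) ->
  `|ell_restr (fun k => k < N)%N x| `^ p <= N%:R * e `^ p.
Proof.
elim: N => [_|N IH xe].
  rewrite mul0r (_ : ell_restr _ x = 0) ?normr0 ?powR0 ?gt_eqF//.
  by apply: ell_ext => k; rewrite ell_restrE.
rewrite (ell_norm_pow_coord N) ell_restrE ltnSn -natr1 mulrDl mul1r addrC.
apply: lerD; last first.
  have xNe : `|x N| <= e by exact: xe.
  by rewrite ler_powRl// (le_trans _ xNe).
rewrite (_ : ell_restr _ _ = ell_restr (fun k => k < N)%N x).
  by apply: IH => k kN; apply: xe; rewrite ltnS ltnW.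
apply: ell_ext => k; rewrite !ell_restrE /= ltnS leq_eqVlt.
by case: eqVneq => //= ->; rewrite ltnn.
Qed.

Lemma ell_basis n (a : R) :
  exists e : ell p1, e n = a /\ forall k, k != n -> e k = 0.
Proof.
have [|e eE] := (@ellP R p p1 (fun k => if k == n then a else 0)).1.
  apply: (@le_lt_trans _ _ (`|a| `^ p)%:E); last by rewrite ltry.
  rewrite (@nneseriesD1 _ _ n) => [||//]; last first.
    by move=> *; rewrite lee_fin powR_ge0.
  rewrite eqxx eseries0 ?adde0// => k _ /negPf ->.
  by rewrite normr0 powR0// gt_eqF.
by exists e; split => [|k /negPf kn]; rewrite -eE ?eqxx ?kn.
Qed.

(** Only coordinate [n] changes, and its new value is at most [2 * |e n|]; the cost is therefore
    additive in [p]-th powers. Applied in l_q, this is the source of the excess of order s^q. *)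
Lemma ell_bump n (v e : ell p1) : (forall k, k != n -> e k = 0) ->
  `|v n| <= `|e n| -> `|v + e| `^ p <= `|v| `^ p + (2 * `|e n|) `^ p.
Proof.
move=> en0 vn; rewrite (ell_norm_pow_coord n) addrC; apply: lerD; last first.
  by rewrite ler_powRl ?mulr_ge0// ellDE (le_trans (ler_normD _ _))//; lra.
rewrite ell_restrD (_ : ell_restr _ e = 0) ?addr0.
  by rewrite ler_powRl// ell_restr_norm_le.
by apply: ell_ext => k; rewrite ell_restrE /=; case: ifP => // /en0.
Qed.

End ell_theory.

(** * Property (beta) of l_p *)

(* The cluster estimate behind property (beta): up to small errors, all the
   [w n] agree on a finite block of coordinates outside of which [x - z]
   vanishes, hence one of them carries a tail of norm at least [s / 4]. The
   tail enters the norm of [w n - x] additively in [p]-th powers, whereas the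
   loss on the block is multiplied by [2 ^ (p - 1)]. *)
Lemma ell_fork (R : realType) (p : R) (p1 : 1 <= p) (a s : R) (x z : ell p1)
    (w : nat -> ell p1) : 1 < p -> 0 < s -> `|x - z| <= a ->
  (forall n, `|w n - z| <= a) ->
  (forall n m, n != m -> s <= `|w n - w m|) ->
  exists n, `|w n - x| `^ p <=
    2 `^ p * a `^ p - (2 `^ (p - 1) - 1) / 2 * (s / 4) `^ p.
Proof.
move=> lt1p s0 xza wza wsep.
have p0 : 0 < p by exact: lt_trans lt1p.
have a0 : 0 <= a := le_trans (normr_ge0 _) xza.
set b := 2 `^ (p - 1).
have b1 : 1 < b.
  have -> : 1 = 1 `^ (p - 1) :> R by rewrite powR1.
  by rewrite ltNge ler_powRl//; lra.
(* [K^p] is the midpoint of 1 and [b]: tails may grow by the factor [K] and half of the gain [b - 1]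
   survives. *)
pose K := ((1 + b) / 2) `^ p^-1.
have Kp : K `^ p = (1 + b) / 2.
  by rewrite -powRrM mulVf ?gt_eqF// powRr1//; lra.
have K0 : 0 <= K by exact: powR_ge0.
have K1 : 1 < K.
  rewrite ltNge; apply/negP => K1.
  by move: K1; rewrite -(ler_powRl p0)// Kp powR1; lra.
(* An error [e] enlarges a tail of norm at least [s / 4] by at most the factor [K]. *)
pose e := (K - 1) * (s / 4).
have e0 : 0 < e by apply: mulr_gt0; lra.
have [N xzN] := ell_tail_small (z - x) e0.
pose A k := (k < N)%N; pose H := @ell_restr R p p1 A.
pose Q := @ell_restr R p p1 (predC A).
have HB u v : H (u - v) = H u - H v by exact: ell_restrB.
have QB u v : Q (u - v) = Q u - Q v by exact: ell_restrB.
have norm_split u : `|u| `^ p = `|H u| `^ p + `|Q u| `^ p.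
  exact: ell_norm_pow_split.
(* With this precision the heads differ by at most [s / 2] in norm, since [N <= (N + 1)^p]; the
   successor also avoids dividing by zero. *)
have [n [m [nm wnm]]] : exists n m, n != m /\
    forall k, (k < N)%N -> `|w n k - w m k| <= s / 2 / N.+1%:R.
  apply: (@bounded_heads_close _ (fun i k => w i k) _ (a + `|z|)).
    by rewrite !divr_gt0.
  move=> i k; apply: (@le_trans _ _ `|w i|); first exact: ell_coord_le.
  by rewrite -(subrK z (w i)) (le_trans (ler_normD _ _))// lerD2r.
have Hwnm : `|H (w n - w m)| <= s / 2.
  rewrite -(ler_powRl p0) ?divr_ge0 ?(ltW s0)//.
  apply: (le_trans (@ell_head_pow_le R p p1 N (w n - w m) _ wnm)).
  set d := s / 2 / _; have -> : s / 2 = N.+1%:R * d.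
    by rewrite [RHS]mulrC /d divfK.
  have d0 : 0 <= d by rewrite !divr_ge0// ltW.
  rewrite powRM// ler_wpM2r ?powR_ge0//.
  apply: le_trans (_ : N.+1%:R <= _); first by rewrite ler_nat.
  by apply: le1r_powR; rewrite ?ler1n.
have Qwnm : s / 2 <= `|Q (w n - w m)|.
  have := wsep _ _ nm.
  suff : `|w n - w m| <= `|H (w n - w m)| + `|Q (w n - w m)| by lra.
  rewrite [X in `|X|](_ : _ = H (w n - w m) + Q (w n - w m)) ?ler_normD//.
  apply: ell_ext => k; rewrite [RHS]ellDE /H /Q !ell_restrE /=.
  by case: (A k); rewrite /= ?addr0 ?add0r.
(* Two tails at distance at least [s / 2] cannot both lie within [s / 4] of the tail of [z]. *)
have [i ti] : exists i, s / 4 <= `|Q (w i - z)|.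
  have : `|Q (w n - w m)| <= `|Q (w n - z)| + `|Q (w m - z)|.
    by rewrite !QB [`|Q (w m) - _|]distrC ler_distD.
  case: (lerP (s / 4) `|Q (w n - z)|) => [? _|? ?]; first by exists n.
  by exists m; lra.
exists i; set t := `|Q (w i - z)| in ti.
have t0 : 0 <= t by exact: normr_ge0.
have Qx : `|Q (w i - x)| `^ p <= (1 + b) / 2 * t `^ p.
  rewrite -Kp -powRM// ler_powRl ?mulr_ge0//.
  have -> : w i - x = (w i - z) + (z - x) by rewrite addrA subrK.
  rewrite [Q _]ell_restrD (le_trans (ler_normD _ _))// -/t.
  have : (K - 1) * (s / 4) <= (K - 1) * t by rewrite ler_wpM2l//; lra.
  by move: xzN; rewrite -/A -/(Q _) /e; lra.
have Hx : `|H (w i - x)| `^ p <= b * (`|H (w i - z)| `^ p + a `^ p).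
  have : `|H (w i - x)| <= `|H (w i - z)| + a.
    rewrite (le_trans (_ : _ <= `|H (w i - z)| + `|H (x - z)|))//.
      by rewrite !HB [`|H x - _|]distrC ler_distD.
    by rewrite lerD2l (le_trans (ell_restr_norm_le _ _)).
  rewrite -(ler_powRl p0) ?addr_ge0// => /le_trans; apply.
  exact: powRD_le.
have wz : `|H (w i - z)| `^ p + t `^ p <= a `^ p.
  by rewrite -norm_split ler_powRl//; exact: wza.
have tp : (s / 4) `^ p <= t `^ p.
  by rewrite ler_powRl//; lra.
have bE : 2 `^ p = 2 * b.
  by rewrite /b mulr_powRB1.
rewrite norm_split bE.
(* The head loses [b * t^p] and the tail returns only [(1 + b) / 2 * t^p], a net gain of
   [(b - 1) / 2 * t^p]. *)
have h1 : b * (`|H (w i - z)| `^ p + a `^ p) <= b * (2 * a `^ p - t `^ p).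
  by rewrite ler_wpM2l ?(ltW (lt_trans ltr01 b1))//; clear -wz; lra.
have h2 : (b - 1) / 2 * (s / 4) `^ p <= (b - 1) / 2 * t `^ p.
  by rewrite ler_wpM2l//; clear -b1; lra.
by clear -Qx Hx h1 h2; lra.
Qed.

(** * Lipschitz and co-Lipschitz estimates at large distances *)

Section large_scale.
Context {R : realType}.
Implicit Types V W : normedModType R.

Lemma segment_step V (u v : V) (n : nat) (r : R) :
  `|v - u| <= n.+1%:R * r ->
  exists m, `|m - u| <= r /\ `|v - m| <= n%:R * r.
Proof.
move=> uv; have n0 : 0 < n.+1%:R :> R by rewrite ltr0n.
exists (u + n.+1%:R^-1 *: (v - u)); split.
  by rewrite addrAC subrr add0r normrZ gtr0_norm ?invr_gt0// ler_pdivrMl.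
rewrite opprD addrA -[X in X - _]scale1r -scalerBl normrZ.
have -> : 1 - n.+1%:R^-1 = n%:R / n.+1%:R :> R.
  by rewrite -natr1; field; rewrite natr1 gt_eqF.
rewrite ger0_norm ?divr_ge0// mulrAC -mulrA ler_wpM2l//.
by rewrite ler_pdivrMr// mulrC.
Qed.

(** A segment is cut into pieces of length at most [d], each contributing at most 1; rounding up the
    number of pieces gives the additive 1. *)
Lemma large_scale_lipschitz V W (T : V -> W) (d : R) : 0 < d ->
  (forall x y, `|x - y| <= d -> `|T x - T y| <= 1) ->
  forall x y, `|T x - T y| <= d^-1 * `|x - y| + 1.
Proof.
move=> d0 Td.
have Tn n : forall x y, `|x - y| <= n%:R * d -> `|T x - T y| <= n%:R.
  elim: n => [|n IH] x y.
    by rewrite mul0r normr_le0 subr_eq0 => /eqP ->; rewrite subrr normr0.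
  move=> /segment_step[m [/Td my /IH xm]].
  by rewrite (le_trans (ler_distD (T m) _ _))// -natr1 lerD.
move=> x y; have t0 : 0 <= d^-1 * `|x - y| by rewrite mulr_ge0// invr_ge0 ltW.
have /andP[] := truncn_itv t0.
set n := Num.truncn _ => nl nr.
rewrite (le_trans (Tn n.+1 x y _))//; last by rewrite -natr1 lerD2r.
by move: nr; rewrite ltr_pdivrMl// mulrC => /ltW.
Qed.

(** [C] is the slope at large distances, the quantity to be improved; [D] absorbs what happens at
    short ones. *)
Definition co_lipschitz_upto V W (T : V -> W) (C D : R) :=
  forall x y, exists w, T w = y /\ `|w - x| <= C * `|y - T x| + D.

(** The segment from [T x] to [y] is lifted piece by piece, each lift starting where the previous
    one ended. *)
Lemma large_scale_co_lipschitz V W (T : V -> W) (d : R) : 0 < d ->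
  (forall x y, `|y - T x| <= d -> exists w, T w = y /\ `|w - x| <= 1) ->
  co_lipschitz_upto T d^-1 1.
Proof.
move=> d0 Td; have Tn n : forall x y, `|y - T x| <= n%:R * d ->
    exists w, T w = y /\ `|w - x| <= n%:R.
  elim: n => [|n IH] x y.
    rewrite mul0r normr_le0 subr_eq0 => /eqP ->.
    by exists x; rewrite subrr normr0.
  move=> /segment_step[m [/Td[u [<- ux]] /IH[w [<- wu]]]].
  exists w; split=> //.
  by rewrite (le_trans (ler_distD u _ _))// -natr1 lerD.
move=> x y; have t0 : 0 <= d^-1 * `|y - T x| by rewrite mulr_ge0// invr_ge0 ltW.
have /andP[] := truncn_itv t0.
set n := Num.truncn _ => nl nr.
have [|w [wy wx]] := Tn n.+1 x y.
  by move: nr; rewrite ltr_pdivrMl// mulrC => /ltW.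
by exists w; split=> //; rewrite (le_trans wx)// -natr1 lerD2r.
Qed.

End large_scale.

(** * The pencil of broken segments and its lifts *)

(* [8 * s] is the ratio of [2 * (s * r)], which bounds the perturbed coordinate,
   to the length [r / 4] of the shortest segment of the pencil.  One factor
   [rho] pays for the perturbation, the other absorbs the additive error [D] at
   large distances. *)
Lemma perturbation_scale (R : realType) (p q c : R) :
  0 < p -> p < q -> 0 < c -> exists s rho : R,
    [/\ 0 < s, 1 < rho, rho `^ q = 1 + (8 * s) `^ q &
        (rho * rho) `^ p <= 1 + c * s `^ p / 2].
Proof.
move=> p0 pq c0; have q0 : 0 < q := lt_trans p0 pq.
have q8 : 0 < 8 `^ q :> R by exact: powR_gt0.
(* As [q - p > 0], [s <= s1] yields [6 * h <= c * s^p] for [h = (8 * s)^q]. The factor 6 comes from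
   [(1 + h)^2 <= 1 + 3 * h], valid once [s <= 1 / 8] ensures [h <= 1]. *)
pose s1 := (c / (6 * 8 `^ q)) `^ (q - p)^-1.
have s10 : 0 < s1 by rewrite powR_gt0// divr_gt0// mulr_gt0.
pose s := Num.min 8^-1 s1.
have s0 : 0 < s by rewrite lt_min s10 andbT invr_gt0.
pose h := (8 * s) `^ q.
have h0 : 0 < h by rewrite powR_gt0// mulr_gt0.
have h1 : h <= 1.
  rewrite -[leRHS](_ : 1 `^ q = 1); last by rewrite powR1.
  rewrite ler_powRl ?(ltW q0)//; last by rewrite mulr_ge0// ltW.
  have : s <= 8^-1 by rewrite ge_min lexx.
  lra.
have hs : 6 * h <= c * s `^ p.
  have : s `^ (q - p) <= c / (6 * 8 `^ q).
    have -> : c / (6 * 8 `^ q) = s1 `^ (q - p).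
      rewrite /s1 -powRrM mulVf ?subr_eq0 ?gt_eqF// powRr1//.
      by rewrite ltW// divr_gt0// mulr_gt0.
    rewrite ler_powRl ?subr_gt0// ?(ltW s0) ?(ltW s10)//.
    by rewrite ge_min lexx orbT.
  rewrite ler_pdivlMr ?mulr_gt0// => sc.
  have sqE : s `^ q = s `^ (q - p) * s `^ p.
    by rewrite -powRD ?subrK// (gt_eqF s0) implybT.
  rewrite /h powRM ?(ltW s0)// sqE.
  have := ler_wpM2r (powR_ge0 s p) sc; lra.
pose rho := (1 + h) `^ q^-1.
have rhoq : rho `^ q = 1 + h.
  by rewrite -powRrM mulVf ?gt_eqF// powRr1//; lra.
exists s, rho; split => //.
  rewrite ltNge -(ler_powRl q0) ?powR_ge0// rhoq powR1; lra.
have rhop : rho `^ p <= 1 + h.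
  rewrite -powRrM; apply: ler1_powR; first lra.
  by rewrite mulrC ler_pdivrMr// mul1r ltW.
rewrite powRM ?powR_ge0//.
have := ler_pM (powR_ge0 rho p) (powR_ge0 rho p) rhop rhop.
have : h * h <= h by rewrite ler_piMr// ltW.
lra.
Qed.

(** The bumps sit at distinct coordinates so far out that those of [v] are at most [b]. Both signs
    occur: [+] on the segment reaching the bumped point, [-] on the one leaving it. *)
Lemma ell_bump_family (R : realType) (p : R) (p1 : 1 <= p) (v : ell p1)
    (b : R) : 0 < b ->
  exists e : nat -> ell p1,
    (forall n m, n != m -> b <= `|e n - e m|) /\
    forall n t u, 0 <= t <= 1 -> 0 <= u ->
      `|t *: v| `^ p + (2 * b) `^ p <= u `^ p ->
      `|t *: v + e n| <= u /\ `|t *: v - e n| <= u.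
Proof.
move=> b0; have p0 : 0 < p := lt_le_trans ltr01 p1.
have [N vN] := ell_tail_small v b0.
have /choice[e eP] : forall n, exists e : ell p1,
    e (N + n)%N = b /\ forall k, k != (N + n)%N -> e k = 0.
  by move=> n; exact: ell_basis.
have eE n : e n (N + n)%N = b by have [] := eP n.
have e0 n k : k != (N + n)%N -> e n k = 0 by have [_] := eP n; exact.
have vb n : `|v (N + n)%N| <= b.
  apply: le_trans vN; set w := ell_restr _ v.
  have := ell_coord_le (N + n) w.
  by rewrite ell_restrE /= -leqNgt leq_addr.
exists e; split=> [n m nm|n t u /andP[t0 t1] u0 tu].
  apply: le_trans (ell_coord_le (N + n) _).
  rewrite ellBE eE e0 ?subr0; last by rewrite eqn_add2l.
  exact: ler_norm.
have tv : `|(t *: v) (N + n)%N| <= b.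
  rewrite [X in `|X|](_ : _ = t * v (N + n)%N)// normrM ger0_norm//.
  by rewrite (le_trans _ (vb n))// ler_piMl.
split; rewrite -(ler_powRl p0) ?normr_ge0//; apply: le_trans tu.
  have := @ell_bump R p p1 (N + n) (t *: v) (e n) (e0 n).
  by rewrite eE (gtr0_norm b0); exact.
have eN : (- e n) (N + n)%N = - b by rewrite -(eE n).
have := @ell_bump R p p1 (N + n) (t *: v) (- e n).
rewrite eN normrN (gtr0_norm b0); apply => // k kn.
by rewrite [LHS](_ : _ = - e n k)// e0// oppr0.
Qed.

(** With [v = y - T x], the legs [v / 4], [v / 4 + e n] and [v / 2 - e n] are lifted in turn. The
    first two lifts have length at most [a], and [ell_fork] finds an [n] for which their endpoint is
    closer to [x] than [2 * a]; the last adds at most [2 * a]. *)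
Lemma fork_lift (R : realType) (p q : R) (p1 : 1 <= p) (q1 : 1 <= q)
    (T : ell p1 -> ell q1) (L C D s rho a : R) (x : ell p1) (y : ell q1) :
  1 < p -> 0 < L -> 0 < s -> 1 < rho -> rho `^ q = 1 + (8 * s) `^ q ->
  0 < C -> 0 <= D -> co_lipschitz_upto T C D ->
  (forall x y, `|T x - T y| <= L * `|x - y| + 1) ->
  2 <= s * `|y - T x| -> C * (rho * `|y - T x| / 4) + D <= a ->
  exists w, T w = y /\ `|w - x| `^ p <= 2 `^ (p - 1) *
    (2 * (2 `^ p * a `^ p) -
     (2 `^ (p - 1) - 1) / 2 * (s * `|y - T x| / (8 * L)) `^ p).
Proof.
move=> lt1p L0 s0 rho1 rhoq C0 D0 TCD TL.
have [v vE] : exists v, v = y - T x by eexists.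
have [r rE] : exists r, r = `|v| by eexists.
rewrite -vE -rE => sr Da.
have p0 : 0 < p := lt_trans ltr01 lt1p.
have q0 : 0 < q := lt_le_trans ltr01 q1.
have rho0 : 0 < rho := lt_trans ltr01 rho1.
have r_ge0 : 0 <= r by rewrite rE.
have sr0 : 0 < s * r by lra.
(* The worst case is the shortest leg, [t = 1 / 4], where [2 * (s * r)] equals [8 * s * (t * r)]. *)
have rho_bound t : 4^-1 <= t -> t <= 1 ->
    `|t *: v| `^ q + (2 * (s * r)) `^ q <= (rho * (t * r)) `^ q.
  move=> t4 t1; have t0 : 0 < t by lra.
  have tr0 : 0 <= t * r by rewrite mulr_ge0 ?(ltW t0).
  rewrite normrZ (gtr0_norm t0) -rE [leRHS]powRM ?(ltW rho0)// rhoq.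
  rewrite [leRHS]mulrDl mul1r lerD2l -powRM//; last first.
    by rewrite mulr_ge0 ?(ltW s0).
  rewrite ler_powRl//.
  - have := ler_wpM2r (ltW sr0) t4; lra.
  - by rewrite mulr_ge0// ltW.
  - by rewrite mulr_ge0// mulr_ge0 ?(ltW s0).
have [e [esep eP]] := ell_bump_family v sr0.
have near_v n t : 4^-1 <= t -> t <= 1 ->
    `|t *: v + e n| <= rho * (t * r) /\ `|t *: v - e n| <= rho * (t * r).
  move=> t4 t1; have t0 : 0 <= t by lra.
  by apply: eP; rewrite ?t0// ?rho_bound// !mulr_ge0 ?(ltW rho0).
have le4 : 4^-1 <= 4^-1 :> R by [].
have le41 : 4^-1 <= 1 :> R by lra.
have le42 : 4^-1 <= 2^-1 :> R by lra.
have le21 : 2^-1 <= 1 :> R by lra.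
have vh : v = 2^-1 *: v + 2^-1 *: v.
  by rewrite -scalerDl -[LHS]scale1r; congr (_ *: _); field.
have vq : 2^-1 *: v = 4^-1 *: v + 4^-1 *: v.
  by rewrite -scalerDl; congr (_ *: _); field.
have rrho : r <= rho * r by rewrite ler_peMl// ltW.
have [z [zm zx]] := TCD x (T x + 4^-1 *: v).
have xza : `|x - z| <= a.
  rewrite distrC (le_trans zx)// (le_trans _ Da)// lerD2r ler_wpM2l ?(ltW C0)//.
  by rewrite addrAC subrr add0r normrZ gtr0_norm ?invr_gt0// -rE mulrC ler_pM2r.
have /choice[w wP] : forall n, exists w,
    T w = T x + 2^-1 *: v + e n /\ `|w - z| <= a.
  move=> n; have [w [wy wz]] := TCD z (T x + 2^-1 *: v + e n).
  exists w; split => //; apply: le_trans wz _; apply: le_trans Da.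
  rewrite lerD2r ler_wpM2l ?(ltW C0)// zm.
  have -> : T x + 2^-1 *: v + e n - (T x + 4^-1 *: v) = 4^-1 *: v + e n.
    by rewrite vq -(addrA (T x)) (addrC (T x)) addrKA addrAC addrK.
  by have [+ _] := near_v n _ le4 le41; rewrite mulrCA mulrC.
(* Since [s * r >= 2], the additive 1 in [TL] costs at most half of the separation, whence
   [2 * L]. *)
have wsep n m : n != m -> s * r / (2 * L) <= `|w n - w m|.
  move=> nm; have := TL (w n) (w m); have [-> _] := wP n; have [-> _] := wP m.
  have := esep _ _ nm; rewrite opprD addrACA subrr add0r.
  rewrite ler_pdivrMr ?mulr_gt0// => h1 h2.
  have : s * r <= L * `|w n - w m| + 1 := le_trans h1 h2.
  by clear -sr; lra.
have s20 : 0 < s * r / (2 * L) by rewrite divr_gt0// mulr_gt0.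
have [n wn] := ell_fork lt1p s20 xza (fun n => (wP n).2) wsep.
have [Twn wnz] := wP n.
have [w' [w'y w'w]] := TCD (w n) y.
exists w'; split => //.
have {}w'w : `|w' - w n| <= 2 * a.
  apply: le_trans w'w _; apply: (@le_trans _ _ (C * (rho * (2^-1 * r)) + D)).
    rewrite lerD2r ler_wpM2l ?(ltW C0)// Twn.
    have -> : y - (T x + 2^-1 *: v + e n) = 2^-1 *: v - e n.
      by rewrite !opprD !addrA -vE {1}vh addrK.
    by have [] := near_v n _ le42 le21.
  by clear -Da D0; lra.
have a0 : 0 <= a := le_trans (normr_ge0 _) xza.
apply: (@le_trans _ _ ((`|w n - x| + 2 * a) `^ p)).
  rewrite ler_powRl ?addr_ge0 ?mulr_ge0//.
  by rewrite (le_trans (ler_distD (w n) _ _))// addrC lerD2l.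
apply: le_trans (powRD_le p1 (normr_ge0 _) (mulr_ge0 _ a0)) _ => //.
rewrite ler_wpM2l ?powR_ge0// (powRM p _ a0)//.
have -> : s * r / (8 * L) = s * r / (2 * L) / 4 by field; rewrite gt_eqF.
by clear -wn; lra.
Qed.

(** * Improvement of the co-Lipschitz constant and contradiction *)

(** The relative gain from [fork_lift] is smallest when [C] is largest, so [lam] can be chosen from
    [C1] alone and serves at every iteration. *)
Lemma co_lipschitz_improve (R : realType) (p q : R) (p1 : 1 <= p)
    (q1 : 1 <= q) (T : ell p1 -> ell q1) (L C1 : R) :
  1 < p -> p < q -> 0 < L -> 0 < C1 ->
  (forall x y, `|T x - T y| <= L * `|x - y| + 1) ->
  exists lam : R, [/\ 0 < lam, lam < 1 & forall C D, 0 < C -> C <= C1 ->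
    0 <= D -> co_lipschitz_upto T C D ->
    exists2 D', 0 <= D' & co_lipschitz_upto T (lam * C) D'].
Proof.
move=> lt1p pq L0 C10 TL; have p0 : 0 < p := lt_trans ltr01 lt1p.
have [b bE] : exists b : R, b = 2 `^ (p - 1) by exists (2 `^ (p - 1)).
have b1 : 1 < b.
  have -> : 1 = 1 `^ (p - 1) :> R by rewrite powR1.
  by rewrite bE ltNge ler_powRl//; lra.
have b0 : 0 < b by lra.
have [g gE] : exists g, g = ((8 * L * C1)^-1) `^ p by eexists.
have g0 : 0 < g by rewrite gE powR_gt0// invr_gt0 !mulr_gt0.
have [c cE] : exists c, c = b * ((b - 1) / 2) * g by eexists.
have c0 : 0 < c by rewrite cE !mulr_gt0// ?divr_gt0//; lra.
have [s [rho [s0 rho1 rhoq rhop]]] := perturbation_scale p0 pq c0.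
have rho0 : 0 < rho := lt_trans ltr01 rho1.
have csp : 0 < c * s `^ p by rewrite mulr_gt0// powR_gt0.
(* The maximum with [1 / 2] keeps [th] positive even if [1 - c * s^p / 2] is not. *)
have [th [th0 th1 thc]] : exists th : R,
    [/\ 0 < th, th < 1 & 1 - c * s `^ p / 2 <= th].
  exists (Num.max 2^-1 (1 - c * s `^ p / 2)); split.
  - by rewrite lt_max invr_gt0 ltr0n.
  - by rewrite gt_max; apply/andP; split; lra.
  - by rewrite le_max lexx orbT.
exists (th `^ p^-1).
have lamp : (th `^ p^-1) `^ p = th.
  by rewrite -powRrM mulVf ?gt_eqF// powRr1// ltW.
move: (th `^ p^-1) (powR_gt0 p^-1 th0) lamp => lam lam0 lamp; split => //.
  by rewrite ltNge -(ler_powRl p0) ?(ltW lam0)// powR1 lamp -ltNge.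
move=> C D C0 CC1 D0 TCD.
have Crho0 : 0 < C * (rho * (rho - 1)) by rewrite !mulr_gt0// subr_gt0.
(* Beyond [r0], the first bound makes [s * r >= 2], and the second lets the spare factor [rho]
   absorb [D]. Up to [r0], the old lift suffices, with [C * r0 + D] as additive constant. *)
have [r0 [r00 r0s r0D]] : exists r0 : R,
    [/\ 0 < r0, 2 / s <= r0 & 4 * D / (C * (rho * (rho - 1))) <= r0].
  exists (Num.max (2 / s) (4 * D / (C * (rho * (rho - 1))))); split.
  - by rewrite lt_max divr_gt0.
  - by rewrite le_max lexx.
  - by rewrite le_max lexx orbT.
exists (C * r0 + D); first by rewrite addr_ge0// mulr_ge0// ltW.
move=> x y; have [r rE] : exists r, r = `|y - T x| by eexists.
have [rr0|rr0] := lerP r r0.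
  have [w [wy wx]] := TCD x y; exists w; split => //.
  rewrite (le_trans wx)// -rE (@le_trans _ _ (C * r0 + D))//.
    by rewrite lerD2r ler_wpM2l// ltW.
  by rewrite lerDr !mulr_ge0 ?(ltW lam0) ?(ltW C0)// rE.
suff [w [wy wx]] : exists w, T w = y /\ `|w - x| <= lam * (C * r).
  exists w; split=> //; rewrite (le_trans wx)// -rE mulrA lerDl.
  by rewrite addr_ge0// mulr_ge0// ltW.
have r_gt0 : 0 < r by exact: lt_trans rr0.
have sr : 2 <= s * r.
  by rewrite mulrC -ler_pdivrMr// (le_trans r0s (ltW rr0)).
have Dr : 4 * D <= r * (C * (rho * (rho - 1))).
  by rewrite -ler_pdivrMr// (le_trans r0D (ltW rr0)).
have [a aE] : exists a, a = C * (rho * rho) * r / 4 by eexists.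
have Da : C * (rho * r / 4) + D <= a by rewrite aE; clear -Dr; lra.
have := @fork_lift _ _ _ _ _ _ _ _ _ _ _ a x y
  lt1p L0 s0 rho1 rhoq C0 D0 TCD TL.
rewrite -rE -bE => /(_ sr Da)[w [wy wx]].
exists w; split => //; have Cr0 : 0 <= C * r by rewrite mulr_ge0 ?ltW.
rewrite -(ler_powRl p0) ?(mulr_ge0 (ltW lam0) Cr0)//.
rewrite (powRM p (ltW lam0) Cr0) lamp; apply: le_trans wx _.
have [X XE] : exists X, X = (C * r) `^ p by eexists.
have X0 : 0 <= X by rewrite XE powR_ge0.
(* As [2 * b = 2^p], the left side is [(4 * a)^p], the bound for the whole lifted path without the
   gain. *)
have apE : b * (2 * (2 `^ p * a `^ p)) = (rho * rho) `^ p * X.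
  have -> : b * (2 * (2 `^ p * a `^ p)) = (2 * b) * (2 `^ p * a `^ p) by ring.
  have -> : 2 * b = 2 `^ p by rewrite bE mulr_powRB1.
  have rho2 : 0 <= rho * rho by rewrite mulr_ge0 ?(ltW rho0).
  have a0 : 0 <= a.
    by rewrite aE divr_ge0// mulr_ge0 ?(ltW r_gt0)// mulr_ge0// ltW.
  rewrite XE -(powRM p rho2 Cr0) -(powRM p (ler0n _ 2) a0).
  rewrite -(powRM p (ler0n _ 2) (mulr_ge0 (ler0n _ 2) a0)).
  by congr (_ `^ p); rewrite aE; field.
have spgE : X * (s `^ p * g) <= (s * r / (8 * L)) `^ p.
  have sL0 : 0 <= s * r / (8 * L) by rewrite divr_ge0 ?mulr_ge0 ?ltW.
  have k0 : 0 <= (8 * L * C1)^-1 by rewrite invr_ge0 !mulr_ge0 ?ltW.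
  have sk0 : 0 <= s * (8 * L * C1)^-1 by rewrite mulr_ge0 ?(ltW s0).
  rewrite gE XE -(powRM p (ltW s0) k0) -(powRM p Cr0 sk0).
  rewrite ler_powRl ?(mulr_ge0 Cr0 sk0)//.
  have -> : C * r * (s * (8 * L * C1)^-1) = s * r / (8 * L) * (C / C1).
    by field; rewrite !gt_eqF.
  by rewrite ler_piMr// ler_pdivrMr// mul1r.
have h1 := ler_wpM2r X0 rhop.
have h2 := ler_wpM2r X0 thc.
have h3 : b * ((b - 1) / 2) * (X * (s `^ p * g)) <=
    b * ((b - 1) / 2) * (s * r / (8 * L)) `^ p.
  apply: ler_wpM2l spgE; rewrite mulr_ge0 ?(ltW b0)// divr_ge0//.
  by rewrite subr_ge0 ltW.
rewrite -XE mulrBr apE mulrA.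
apply: le_trans (lerB h1 h3) _; apply: le_trans h2; rewrite cE.
by rewrite le_eqVlt; apply/orP; left; apply/eqP; field.
Qed.

(** Lifting a point [T 0 + e] gives [|e| <= L * (C * |e| + D) + 1], which fails for large [|e|] if
    [L * C < 1]. *)
Lemma co_lipschitz_lower_bound (R : realType) (p q : R) (p1 : 1 <= p)
    (q1 : 1 <= q) (T : ell p1 -> ell q1) (L C D : R) : 0 < L ->
  (forall x y, `|T x - T y| <= L * `|x - y| + 1) ->
  co_lipschitz_upto T C D -> L^-1 <= C.
Proof.
move=> L0 TL TCD; rewrite leNgt; apply/negP => CL.
have LC : 0 < 1 - L * C by rewrite subr_gt0 mulrC -ltr_pdivlMr// mul1r.
pose N := (L * `|D| + 1) / (1 - L * C) + 1.
have [e [eN _]] := @ell_basis R q q1 0 N.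
have Ne : N <= `|e|.
  by apply: le_trans (ler_norm _) _; rewrite -eN; exact: ell_coord_le.
have [w [wy w0]] := TCD 0 (T 0 + e).
have {}w0 : `|w| <= C * `|e| + D.
  by move: w0; rewrite subr0 [T 0 + e]addrC addrK.
have := TL w 0; rewrite wy subr0 [T 0 + e]addrC addrK => eL.
have wL := ler_wpM2l (ltW L0) w0.
have DL : L * D <= L * `|D| by rewrite ler_wpM2l ?(ltW L0)// ler_norm.
have : N * (1 - L * C) <= `|e| * (1 - L * C) by rewrite ler_wpM2r// ltW.
rewrite /N mulrDl divfK ?gt_eqF// mul1r; lra.
Qed.

Theorem theorem4p1 (R : realType) (p q : R) (hp : 1 < p) (hpq : p < q) :
  ~ uniform_quotient_of (ell (ltW (lt_trans hp hpq))) (ell (ltW hp)).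
Proof.
move=> [T [[/metric_unif_continuousP uT coT] _]].
have [d d0 Td] := uT 1 ltr01; have [d' d'0 Td'] := coT 1 ltr01.
(* Halving [d] turns the strict hypothesis of [Td] into the weak one of [large_scale_lipschitz]. *)
have dV0 : 0 < (d / 2)^-1 by rewrite invr_gt0 divr_gt0.
have TL : forall x y, `|T x - T y| <= (d / 2)^-1 * `|x - y| + 1.
  apply: large_scale_lipschitz => [|x y xy]; first by rewrite divr_gt0.
  by apply: ltW; apply: Td; apply: le_lt_trans xy _; lra.
have TC : co_lipschitz_upto T d'^-1 1.
  apply: large_scale_co_lipschitz => // x y xy.
  have [|w wx wy] := Td' x y; first by rewrite distrC in xy.
  by exists w; split; rewrite // distrC.
have C10 : 0 < d'^-1 by rewrite invr_gt0.
have [lam [lam0 lam1 improve]] := co_lipschitz_improve hp hpq dV0 C10 TL.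
have iterate n : exists2 D, 0 <= D & co_lipschitz_upto T (lam ^+ n * d'^-1) D.
  elim: n => [|n [D D0 TD]]; first by exists 1; rewrite // expr0 mul1r.
  rewrite exprS -mulrA; apply: improve TD => //.
    by rewrite mulr_gt0// exprn_gt0.
  by rewrite ler_piMl ?(ltW C10)// exprn_ile1// ltW.
have lower n : d / 2 <= lam ^+ n * d'^-1.
  have [D D0 TD] := iterate n.
  by have := co_lipschitz_lower_bound dV0 TL TD; rewrite invrK.
have lam_norm : `|lam| < 1 by rewrite gtr0_norm.
(* [lower] keeps [lam ^+ n] above this constant, although the powers tend to 0. *)
have eps0 : 0 < d / 2 * d' by rewrite mulr_gt0// divr_gt0.
have /cvgrPdist_lt/(_ _ eps0)[n _ /(_ n (leqnn n))/=] := cvg_expr lam_norm.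
rewrite sub0r normrN gtr0_norm ?exprn_gt0// -ltr_pdivrMr//.
by rewrite ltNge lower.
Qed.
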